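(* (A Chain Rule for Nonsmooth Functions.) Assume $h:\mathbb{R}^m\to\mathbb{R}$ and $g_1,\dots,g_m:\mathbb{R}^d\to\mathbb{R}$ are locally Lipschitz functions computable by branching programs (see context), and that $h$ is overloaded with an automatic subdifferentiation subroutine $\mathrm{ASD}[h]$ (see context). Define $$f(x)=h(g_1(x),\dots,g_m(x))=h(g(x)),$$ where $g(x)=(g_1(x),\dots,g_m(x))^\top$. Let $x\in\mathbb{R}^d$. For $v\in\mathbb{R}^d$, denote by $D[g;v](x)$ the $m\times1$ vector of one-sided directional derivatives $D[g_i;v](x)$ and, if it exists, let $\partial[g;v](x)$ denote the $m\times d$ limiting Jacobian matrix whose rows are the vectors $\partial[g_i;v](x)$. Set $$[a,\mathrm{d},u]=\mathrm{ASD}[h]\big(g(x);D[g;v](x)\big).$$ Then for all but a measure $0$ set of $v\in\mathbb{R}^d$, both $\partial[f;v](x)$ and $\partial[g;v](x)$ exist and $$\partial[f;v](x)=\partial[g;v](x)^\top u .$$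
   Context: **Branching program (computational model).** A function $g:\mathbb{R}^d\to\mathbb{R}$ ($d$ and $T$ may differ for each function) is computed by a program of the following form. Input $x=(x_1,\dots,x_d)$. Initialize $z\in\{-1,1\}^T$ to be all $-1$'s. For $k=d+1,\dots,T$: compute $x_k=g_{k,z}(x_{\mathrm{parents}(k,z)})$, where $\mathrm{parents}(k,z)\subseteq\{1,\dots,k-1\}$ and $g_{k,z}$ is either a monomial or an affine function of its inputs; if the program branches at $(k,z)$, set $z_k=1$ if $x_k\ge 0$ and $z_k=-1$ otherwise; if the program halts at $(k,z)$, terminate the loop. Return $x_k$. Which monomial/affine function and which parents are used, and whether the program branches or halts at step $k$, is determined by $k$ and the current $z$ (that is, by the outcomes of the earlier branchings). The program always terminates within the time bound $T$. **Piecewise representation.** For $z\in\{-1,1\}^T$, let $x_k$ along branch $z$ denote the polynomial in the input $x$ obtained at step $k$ when the branching outcomes are those prescribed by $z$. Put $h_{k,z}(x)=x_k$ for steps $k$ at which the program branches on $z$, put $h_{k,z}(x)=-1$ for all other $k$, and let $h_z(x)=(h_{1,z}(x),\dots,h_{T,z}(x))$. (These constraint functions are not to be confused with the function $h$ of the claim.) Let $\mathrm{sign}$ act componentwise with values in $\{-1,1\}$ and $\mathrm{sign}(0)=1$, and let $S_z=\{x:\mathrm{sign}(h_z(x))=z\}$ (the inputs on which the program executes branch $z$). The function computed is represented as $\sum_{z\in\{-1,1\}^T}\mathbb{I}_{S_z}(x)\,p_z(x)$, where $\mathbb{I}_{S_z}$ is the indicator function of $S_z$ and $p_z$ is the polynomial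 output along branch $z$. **Directional derivative.** $D[g;v](x)=\lim_{\delta\downarrow0}\frac{g(x+\delta v)-g(x)}{\delta}$ ($v$ is not assumed to be a unit vector). **Limiting total derivative.** For locally Lipschitz $\phi$, $\partial[\phi;v](x)=\lim_{\delta\downarrow0}\nabla\phi(x+\delta v)$, if the limit exists. **ASD subroutine.** A function $\phi$ with representation $\phi(y)=\sum_{z}\mathbb{I}_{S_z}(y)p_z(y)$ is overloaded with an automatic subdifferentiation subroutine $\mathrm{ASD}[\phi]$ if, on any input $(y;w)$ (with $y,w$ of the input dimension of $\phi$), the output $[a,\mathrm{d},u]=\mathrm{ASD}[\phi](y;w)$ satisfies $a=\phi(y)$, $\mathrm{d}=D[\phi;w](y)$, and $u=\nabla p_z(y)$, where $z$ is such that $\lim_{\delta\downarrow0}\mathbb{I}_{S_z}(y+\delta w)=1$. *)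

(* Defs.v *)
From HB Require Import structures.
From mathcomp Require Import all_boot all_order all_algebra.
From mathcomp Require Import all_classical all_reals all_analysis.
Set Implicit Arguments.
Unset Strict Implicit.
Unset Printing Implicit Defensive.
Import Order.TTheory GRing.Theory Num.Theory.
Import numFieldNormedType.Exports.
Local Open Scope classical_set_scope.
Local Open Scope ring_scope.

(* Vectors of R^n are columns 'cV[R]_n.                                       *)
(*                                                                            *)
(* Variables and steps of a program are numbered from 0: x_0, ..., x_(d-1)    *)
(* are the inputs and the loop runs over the steps k with d <= k < T.         *)
(*                                                                            *)
(* A vector of {-1, 1}^T is encoded by booleans: true stands for 1 and false  *)
(* for -1, so that sign(r), with sign(0) = 1, is the boolean 0 <= r.          *)
Definition signs (T : nat) := {ffun 'I_T -> bool}.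

Definition minus_ones (T : nat) : signs T := [ffun=> false].

Definition set_sign (T : nat) (z : signs T) (k : nat) (b : bool) : signs T :=
  [ffun i : 'I_T => if i == k :> nat then b else z i].

(* The value of the variable z of a run following the branch z, once the      *)
(* steps before k have been executed.                                         *)
Definition signs_before (T : nat) (z : signs T) (k : nat) : signs T :=
  [ffun i : 'I_T => (i < k)%N && z i].

Inductive operation (R : realType) (k : nat) :=
| Monomial (c : R) (e : 'I_k -> nat)
| Affine (b : R) (a : 'I_k -> R).

(* An operation only reads the variables whose index is in A. *)
Definition eval_operation (R : realType) (k : nat) (o : operation R k)
    (A : {set 'I_k}) (s : seq R) : R :=
  match o with
  | Monomial c e => c * \prod_(j in A) s`_j ^+ e j
  | Affine b a => b + \sum_(j in A) a j * s`_j
  end.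

Record program (R : realType) (T : nat) := Program {
  parents : forall k : nat, signs T -> {set 'I_k};
  op : forall k : nat, signs T -> operation R k;
  branches : nat -> signs T -> bool;
  halts : nat -> signs T -> bool
}.

Definition inputs (R : realType) (d : nat) (x : 'cV[R]_d) : seq R :=
  [seq x i 0 | i <- enum 'I_d].

Definition eval_step (R : realType) (T : nat) (P : program R T)
    (k : nat) (z : signs T) (s : seq R) : R :=
  eval_operation (op P k z) (parents P k z) s.

(* Executes at most n further steps from the computed variables s and the     *)
(* signs z; None means that the program has not halted. As in a sequential    *)
(* reading of the loop, the halting test sees the sign set by a branching at  *)
(* the same step.                                                             *)
Fixpoint run_from (R : realType) (T : nat) (P : program R T)
    (n : nat) (s : seq R) (z : signs T) : option R :=
  if n is n'.+1 then
    let k := size s in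
    let xk := eval_step P k z s in
    let z' := if branches P k z then set_sign z k (0 <= xk) else z in
    if halts P k z' then Some xk else run_from P n' (rcons s xk) z'
  else None.

Definition run (R : realType) (d T : nat) (P : program R T) (x : 'cV[R]_d) :
    option R :=
  run_from P (T - d) (inputs x) (minus_ones T).

(* This includes that the program halts within the time bound on every input. *)
Definition computes (R : realType) (d T : nat) (P : program R T)
    (g : 'cV[R]_d -> R) : Prop :=
  forall x, run P x = Some (g x).

Definition computable (R : realType) (d : nat) (g : 'cV[R]_d -> R) : Prop :=
  exists (T : nat) (P : program R T), computes P g.

Section piecewise_representation.
Variables (R : realType) (d T : nat) (P : program R T).
Implicit Types (z : signs T) (x : 'cV[R]_d).

(* The inputs followed by the variables of the first n steps along z. *)
Fixpoint branch_values z x (n : nat) : seq R :=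
  if n is n'.+1 then
    let s := branch_values z x n' in
    let k := size s in
    rcons s (eval_step P k (signs_before z k) s)
  else inputs x.

(* x_k along branch z, as a polynomial function of the input x. *)
Definition branch_var z (k : nat) x : R := (branch_values z x (k.+1 - d))`_k.

(* The first step at which the program halts along z. If there is none, which *)
(* is only possible when branch_set z is empty if the program always          *)
(* terminates, its value is irrelevant.                                       *)
Definition halt_step z : nat :=
  d + find (fun k => halts P k (signs_before z k.+1)) (iota d (T - d)).

(* The function h_(k,z). *)
Definition branch_constraint z (k : 'I_T) x : R :=
  if (d <= k <= halt_step z)%N && branches P k (signs_before z k)
  then branch_var z k x else -1.

(* The set S_z. *)
Definition branch_set z : set 'cV[R]_d :=
  [set x | forall k : 'I_T, (0 <= branch_constraint z k x) = z k].

(* The function p_z. *)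
Definition branch_output z x : R := branch_var z (halt_step z) x.

End piecewise_representation.

Definition dirder (R : realType) (n : nat) (phi : 'cV[R]_n -> R)
    (v x : 'cV[R]_n) : R :=
  lim ((phi (x + delta *: v) - phi x) / delta @[delta --> 0^'+]).

Definition grad (R : realType) (n : nat) (phi : 'cV[R]_n -> R)
    (x : 'cV[R]_n) : 'cV[R]_n :=
  \col_i 'D_(delta_mx i 0) phi x.

(* The limiting total derivative of phi at x along v exists and is w; the     *)
(* gradient has to exist at x + delta v for all small delta > 0.              *)
Definition is_limder (R : realType) (n : nat) (phi : 'cV[R]_n -> R)
    (v x w : 'cV[R]_n) : Prop :=
  (\forall delta \near 0^'+, differentiable phi (x + delta *: v)) /\
  grad phi (x + delta *: v) @[delta --> 0^'+] --> w.

Definition is_limjac (R : realType) (d m : nat) (g : 'I_m -> 'cV[R]_d -> R)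
    (v x : 'cV[R]_d) (J : 'M[R]_(m, d)) : Prop :=
  forall i, is_limder (g i) v x (row i J)^T.

(* The output (a, c, u) of an automatic subdifferentiation subroutine for a   *)
(* function phi computed by the program P: value, directional derivative and  *)
(* gradient of the polynomial of the branch z entered by y + delta w.         *)
Definition is_ASD (R : realType) (n T : nat) (P : program R T)
    (phi : 'cV[R]_n -> R)
    (asd : 'cV[R]_n -> 'cV[R]_n -> R * R * 'cV[R]_n) : Prop :=
  forall y w, let: (a, c, u) := asd y w in
  [/\ a = phi y,
      c = dirder phi w y &
      exists2 z : signs T,
        (\1_(branch_set P z) (y + delta *: w) : R) @[delta --> 0^'+] --> (1 : R)
      & u = grad (branch_output P z) y].

Definition locally_lipschitz (R : realType) (n : nat) (phi : 'cV[R]_n -> R) :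
    Prop :=
  forall x : 'cV[R]_n, exists2 U : set 'cV[R]_n, nbhs x U & [lipschitz phi y | y in U].

(* Lebesgue null sets of R^n: N can be covered by countably many closed boxes *)
(* of arbitrarily small total volume. The index set B allows finite and empty *)
(* covers, which matters for n = 0, where every box has volume 1.             *)
Definition lebesgue_null (R : realType) (n : nat) (N : set 'cV[R]_n) : Prop :=
  forall e : R, 0 < e ->
  exists (B : pred nat) (a b : nat -> 'cV[R]_n),
  [/\ forall k i, a k i 0 <= b k i 0,
      N `<=` \bigcup_(k in [set j | B j])
               [set x : 'cV[R]_n | forall i, a k i 0 <= x i 0 <= b k i 0] &
      (\sum_(0 <= k <oo | B k) (\prod_i (b k i 0 - a k i 0))%:E <= e%:E)%E].

(* Main.v *)
Require Import Defs.
From HB Require Import structures.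
From mathcomp Require Import all_boot all_order all_algebra.
From mathcomp Require Import all_classical all_reals all_analysis.
From mathcomp Require Import ring lra.
Set Implicit Arguments.
Unset Strict Implicit.
Unset Printing Implicit Defensive.
Import Order.TTheory GRing.Theory Num.Theory.
Import numFieldNormedType.Exports.
Local Open Scope classical_set_scope.
Local Open Scope ring_scope.

(** Each branch of a program computes a polynomial on a set cut out by finitely
many polynomial signs.  Along a ray t |-> y + t J v, a polynomial r has an
expansion r(y + t J v) = sum_k t^k r_k(v) with coefficients r_k polynomial in v.
If k is the least index for which r_k is not identically zero, then wherever
r_k(v) <> 0 the sign of r(y + t J v') is the sign of r_k(v) for all v' near v and
all small t > 0: it is constant on a thin truncated cone around the ray
([poly_family_sign_near]).  The exceptional v lie in the zero set of a nonzero
polynomial, a null set ([lebesgue_null_zeros]), and only finitely many r, y, J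
occur.  So for almost every v the following holds on such a cone
([settled_null], [settled_branch]).

- Each g_i follows a single branch: g_i = p_i at the points x + t v'.  Hence
  the limiting Jacobian exists and is the matrix J of the gradients of the p_i
  at x ([cone_limder]), and J v' is the directional derivative of g along every
  v' near v.
- The composite of h with the p_i follows a single branch of h, so f = q at the
  points x + t v' for a polynomial q, and the limiting derivative of f is
  grad q (x).
- The affine rays y + t J v', y = g(x), all stay in the branch of h that the
  subroutine follows along J v.  Hence the directional derivative of h at y along
  J v' is u . J v', for every v' near v.  This branch may differ from the one
  followed by f, and its set may have empty interior.

As h is Lipschitz near y and g(x + t v') = y + t J v' + o(t), the directional
derivative of f along v' is that of h along J v' ([lipschitz_chain_quotient]),
so grad q (x) . v' = u . J v' for all v' in a neighbourhood of v.  Two linear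
forms that agree on an open set are equal, which gives grad q (x) = J^T u
([chain_rule_settled]).

The null set of zeros comes from a version of the Schwartz-Zippel lemma that
holds uniformly under translation ([grid_sparse]): on a cubic grid of N^n points
with a given spacing, only O(N^(n-1)) points can carry very small values of a
nonzero polynomial.  Translates of such grids superpose into a grid so fine that
the polynomial is very small at the corner of every cell that meets its zero set;
these cells then have total volume O(1/N). *)

(** * Lebesgue null sets *)

Definition box (R : realType) (n : nat) (a b : 'cV[R]_n) : set 'cV[R]_n :=
  [set x | forall i, a i 0 <= x i 0 <= b i 0].

Definition box_volume (R : realType) (n : nat) (a b : 'cV[R]_n) : R :=
  \prod_i (b i 0 - a i 0).

Lemma box_volume_ge0 (R : realType) (n : nat) (a b : 'cV[R]_n) :
  (forall i, a i 0 <= b i 0) -> 0 <= box_volume a b.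
Proof. by move=> ab; apply: prodr_ge0 => i _; rewrite subr_ge0. Qed.

Lemma lebesgue_null_sub (R : realType) (n : nat) (M N : set 'cV[R]_n) :
  M `<=` N -> lebesgue_null N -> lebesgue_null M.
Proof.
move=> MN null_N e /null_N[B [a [b [ab NB volB]]]].
by exists B, a, b; split=> //; exact: subset_trans NB.
Qed.

(** Any countable index type will do for the covers, since [pickle] transports
it to a set of natural numbers. *)
Lemma lebesgue_null_countable_cover (R : realType) (n : nat) (N : set 'cV[R]_n) :
  (forall e : R, 0 < e -> exists (I : countType) (B : set I) (a b : I -> 'cV[R]_n),
    [/\ forall k i, a k i 0 <= b k i 0,
        N `<=` \bigcup_(k in B) box (a k) (b k) &
        (\esum_(k in B) (box_volume (a k) (b k))%:E <= e%:E)%E]) ->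
  lebesgue_null N.
Proof.
move=> cover e /cover[I [B [a [b [ab NB volB]]]]].
pose on (c : I -> 'cV[R]_n) j := if unpickle j is Some k then c k else 0.
pose B' j := `[< exists2 k : I, B k & pickle k = j >].
exists B', (on a), (on b); split.
- by move=> j i; rewrite /on; case: unpickle.
- move=> x /NB[k Bk xk]; exists (pickle k); first by apply/asboolP; exists k.
  by rewrite /on /= pickleK.
- rewrite nneseries_esum; last first.
    move=> j /asboolP[k _ <-]; rewrite /on pickleK lee_fin.
    exact: box_volume_ge0.
  have -> : [set j | B' j] = pickle @` B.
    apply/seteqP; split=> [j /asboolP[k Bk <-]|_ [k Bk <-]]; first by exists k.
    by apply/asboolP; exists k.
  rewrite esum_image; last by move=> i j _ _; exact: (pcan_inj pickleK).
  by under eq_esum do rewrite /on pickleK.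
Qed.

Lemma lebesgue_null0 (R : realType) (n : nat) : lebesgue_null (@set0 'cV[R]_n).
Proof.
apply: lebesgue_null_countable_cover => e e0.
by exists nat, set0, (fun=> 0), (fun=> 0); split=> //; rewrite esum_set0 lee_fin ltW.
Qed.

(** The k-th set is covered with total volume e / 2^(k+1), and all these covers
are put together in one cover indexed by pairs. *)
Lemma lebesgue_null_bigcup_nat (R : realType) (n : nat) (N : nat -> set 'cV[R]_n) :
  (forall k, lebesgue_null (N k)) -> lebesgue_null (\bigcup_k N k).
Proof.
move=> null_N; apply: lebesgue_null_countable_cover => e e0.
have cover k : exists B : pred nat * (nat -> 'cV[R]_n) * (nat -> 'cV[R]_n),
  [/\ forall j i, B.1.2 j i 0 <= B.2 j i 0,
      N k `<=` \bigcup_(j in [set j | B.1.1 j]) box (B.1.2 j) (B.2 j) &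
      (\sum_(0 <= j <oo | B.1.1 j) (box_volume (B.1.2 j) (B.2 j))%:E
         <= (e / (2 ^ k.+1)%:R)%:E)%E].
  have e2_gt0 : 0 < e / (2 ^ k.+1)%:R by rewrite divr_gt0// ltr0n expn_gt0.
  have [B [a [b [? ? ?]]]] := null_N k _ e2_gt0.
  by exists (B, a, b).
have [B BP] := choice cover.
have vol0 k j : (0 <= (box_volume ((B k).1.2 j) ((B k).2 j))%:E)%E.
  by have [ab _ _] := BP k; rewrite lee_fin box_volume_ge0.
exists (nat * nat)%type, ([set: nat] `*`` (fun k => [set j | (B k).1.1 j])),
  (fun kj => (B kj.1).1.2 kj.2), (fun kj => (B kj.1).2 kj.2); split.
- by move=> [k j] i; have [ab _ _] := BP k; exact: ab.
- move=> x [k _ Nkx]; have [_ /(_ x Nkx)[j Bj xj] _] := BP k.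
  by exists (k, j).
- rewrite -(@esum_esum _ _ _ _ _
    (fun k j => (box_volume ((B k).1.2 j) ((B k).2 j))%:E))//.
  rewrite -nneseries_esumT; last by move=> k; apply: esum_ge0.
  apply: (@le_trans _ _ (\sum_(0 <= k <oo | xpredT k) (e / (2 ^ k.+1)%:R)%:E)%E).
    apply: lee_nneseries => [k _ _|k _]; first by apply: esum_ge0 => j _.
    have [_ _] := BP k.
    by rewrite nneseries_esum.
  by apply: epsilon_trick0; exact: ltW.
Qed.

Lemma lebesgue_null_bigcup (R : realType) (n : nat) (I : countType)
    (N : I -> set 'cV[R]_n) :
  (forall k, lebesgue_null (N k)) -> lebesgue_null (\bigcup_k N k).
Proof.
move=> null_N.
apply: (@lebesgue_null_sub _ _ _
  (\bigcup_j (if unpickle j is Some k then N k else set0))).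
  by move=> x [k _ Nkx]; exists (pickle k); rewrite ?pickleK.
by apply: lebesgue_null_bigcup_nat => j; case: unpickle => //; exact: lebesgue_null0.
Qed.

Lemma lebesgue_null_forall (R : realType) (n : nat) (I : countType)
    (Q : I -> 'cV[R]_n -> Prop) :
  (forall i, lebesgue_null [set v | ~ Q i v]) ->
  lebesgue_null [set v | ~ forall i, Q i v].
Proof.
move=> null_Q; apply: lebesgue_null_sub (lebesgue_null_bigcup null_Q) => v /=.
by move=> /existsNP[i Qi]; exists i.
Qed.

Lemma lebesgue_null_and (R : realType) (n : nat) (Q1 Q2 : 'cV[R]_n -> Prop) :
  lebesgue_null [set v | ~ Q1 v] -> lebesgue_null [set v | ~ Q2 v] ->
  lebesgue_null [set v | ~ (Q1 v /\ Q2 v)].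
Proof.
move=> null1 null2.
have := @lebesgue_null_forall _ _ bool (fun b => if b then Q1 else Q2).
move=> /(_ _)/(lebesgue_null_sub _); apply; last by case.
by move=> v; apply: contra_not => all_b; split;
  [exact: (all_b true)|exact: (all_b false)].
Qed.

(** * Polynomial functions and polynomial families *)

(** Polynomial functions, not formal polynomials: the facts used about them are
inductions on their construction, and programs are evaluated on values. *)
Inductive polyfun (R : realType) (n : nat) : ('cV[R]_n -> R) -> Prop :=
| polyfun_cst c : polyfun (fun=> c)
| polyfun_coord i : polyfun (fun x => x i 0)
| polyfunD f g : polyfun f -> polyfun g -> polyfun (fun x => f x + g x)
| polyfunM f g : polyfun f -> polyfun g -> polyfun (fun x => f x * g x).

Lemma eq_polyfun (R : realType) (n : nat) (f g : 'cV[R]_n -> R) :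
  f =1 g -> polyfun f -> polyfun g.
Proof. by move=> /funext ->. Qed.

Lemma polyfun_sum (R : realType) (n : nat) (I : Type) (r : seq I) (P : pred I)
    (f : I -> 'cV[R]_n -> R) :
  (forall i, polyfun (f i)) -> polyfun (fun x => \sum_(i <- r | P i) f i x).
Proof.
move=> pf; elim: r => [|i r IHr].
  by apply: eq_polyfun (polyfun_cst _ 0) => x; rewrite big_nil.
have [Pi|Pi] := boolP (P i).
  by apply: eq_polyfun (polyfunD (pf i) IHr) => x; rewrite big_cons Pi.
by apply: eq_polyfun IHr => x; rewrite big_cons (negPf Pi).
Qed.

Lemma polyfun_prod (R : realType) (n : nat) (I : Type) (r : seq I) (P : pred I)
    (f : I -> 'cV[R]_n -> R) :
  (forall i, polyfun (f i)) -> polyfun (fun x => \prod_(i <- r | P i) f i x).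
Proof.
move=> pf; elim: r => [|i r IHr].
  by apply: eq_polyfun (polyfun_cst _ 1) => x; rewrite big_nil.
have [Pi|Pi] := boolP (P i).
  by apply: eq_polyfun (polyfunM (pf i) IHr) => x; rewrite big_cons Pi.
by apply: eq_polyfun IHr => x; rewrite big_cons (negPf Pi).
Qed.

Lemma polyfunX (R : realType) (n : nat) (f : 'cV[R]_n -> R) (e : nat) :
  polyfun f -> polyfun (fun x => f x ^+ e).
Proof.
move=> pf; elim: e => [|e IHe]; first exact: polyfun_cst.
by apply: eq_polyfun (polyfunM pf IHe) => x; rewrite exprS.
Qed.

Lemma polyfun_comp (R : realType) (m n : nat) (f : 'cV[R]_m -> R)
    (u : 'I_m -> 'cV[R]_n -> R) :
  polyfun f -> (forall i, polyfun (u i)) ->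
  polyfun (fun x => f (\col_i u i x)).
Proof.
move=> pf pu; elim: pf => [c|i|g h _ pg _ ph|g h _ pg _ ph].
- exact: polyfun_cst.
- by apply: eq_polyfun (pu i) => x; rewrite mxE.
- exact: polyfunD.
- exact: polyfunM.
Qed.

Lemma polyfun_mulmx (R : realType) (m n : nat) (J : 'M[R]_(m, n)) (i : 'I_m) :
  polyfun (fun v : 'cV[R]_n => (J *m v) i 0).
Proof.
under eq_fun do rewrite mxE.
by apply: polyfun_sum => j; apply: polyfunM; [exact: polyfun_cst|exact: polyfun_coord].
Qed.

(** Functions that are polynomial in (x, t) jointly, presented as polynomials in t
whose coefficients are polynomial functions of x.  The bound on the size is
uniform in x, so F is a finite sum of terms a_k(x) t^k, and there is a largest k
for which a_k is not identically zero. *)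
Definition poly_family (R : realType) (n : nat) (F : 'cV[R]_n -> R -> R) : Prop :=
  exists (P : 'cV[R]_n -> {poly R}) (N : nat),
    [/\ forall k, polyfun (fun x => (P x)`_k),
        forall x, (size (P x) <= N)%N &
        forall x t, F x t = (P x).[t]].

Lemma poly_family_cst (R : realType) (n : nat) (f : 'cV[R]_n -> R) :
  polyfun f -> poly_family (fun x _ => f x).
Proof.
move=> pf; exists (fun x => (f x)%:P), 1%N; split=> [k|x|x t].
- have [->|k0] := eqVneq k 0%N; first by apply: eq_polyfun pf => x; rewrite coefC.
  by apply: eq_polyfun (polyfun_cst _ 0) => x; rewrite coefC (negPf k0).
- exact: size_polyC_leq1.
- by rewrite hornerC.
Qed.

Lemma poly_family_var (R : realType) (n : nat) :
  poly_family (fun (_ : 'cV[R]_n) t => t).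
Proof.
exists (fun=> 'X), 2; split=> [k|x|x t]; first exact: polyfun_cst.
- by rewrite size_polyX.
- by rewrite hornerX.
Qed.

Lemma poly_familyD (R : realType) (n : nat) (F G : 'cV[R]_n -> R -> R) :
  poly_family F -> poly_family G -> poly_family (fun x t => F x t + G x t).
Proof.
move=> [P [N [pP sP FP]]] [Q [M [pQ sQ GQ]]].
exists (fun x => P x + Q x), (maxn N M); split=> [k|x|x t].
- by apply: eq_polyfun (polyfunD (pP k) (pQ k)) => x; rewrite coefD.
- by rewrite (leq_trans (size_polyD _ _))// geq_max !leq_max sP sQ orbT.
- by rewrite hornerD FP GQ.
Qed.

Lemma poly_familyM (R : realType) (n : nat) (F G : 'cV[R]_n -> R -> R) :
  poly_family F -> poly_family G -> poly_family (fun x t => F x t * G x t).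
Proof.
move=> [P [N [pP sP FP]]] [Q [M [pQ sQ GQ]]].
exists (fun x => P x * Q x), (N + M)%N; split=> [k|x|x t].
- apply: eq_polyfun (polyfun_sum (index_enum 'I_k.+1) xpredT
    (fun i => polyfunM (pP i) (pQ (k - i)%N))) => x.
  by rewrite coefM.
- by rewrite (leq_trans (size_polyMleq _ _))// (leq_trans (leq_pred _))// leq_add.
- by rewrite hornerM FP GQ.
Qed.

(** This covers both expansions in use: of a polynomial in one of its variables,
and of a polynomial along rays issued from a point. *)
Lemma poly_family_comp (R : realType) (m n : nat) (f : 'cV[R]_m -> R)
    (u : 'I_m -> 'cV[R]_n -> R -> R) :
  polyfun f -> (forall i, poly_family (u i)) ->
  poly_family (fun x t => f (\col_i u i x t)).
Proof.
move=> pf pu; elim: pf => [c|i|g h _ pg _ ph|g h _ pg _ ph].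
- exact/poly_family_cst/polyfun_cst.
- rewrite (_ : (fun _ _ => _) = u i); first exact: pu.
  by apply/funext => x; apply/funext => t; rewrite mxE.
- exact: poly_familyD.
- exact: poly_familyM.
Qed.

(** * Zero sets of polynomials *)

(** Divided differences: dividing q - q(t) by 'X - t preserves the top coefficient,
lowers the degree by one and multiplies the bound at the other points by at most
2 / s.  The points only enter through their mutual distances, which is what makes
the estimates below uniform under translation. *)
Lemma coef_le_of_spread (R : realType) (D : nat) (q : {poly R}) (s eta : R)
    (ts : seq R) :
  0 < s -> (size q <= D.+1)%N -> size ts = D.+1 ->
  pairwise (fun a b => s <= `|a - b|) ts ->
  {in ts, forall t, `|q.[t]| <= eta} -> `|q`_D| <= eta * (2 / s) ^+ D.
Proof.
move=> s0; elim: D q eta ts => [|D IHD] q eta [|t ts]//= sq.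
  move=> _ _ /(_ t); rewrite mem_head => /(_ isT).
  by rewrite [q in q.[t]]size1_polyC// hornerC mulr1.
move=> [sts] /andP[t_far pw] small.
have : root (q - q.[t]%:P) t by rewrite /root !hornerE subrr.
move=> /factor_theorem[r qr].
have sr : (size r <= D.+1)%N.
  have [->|r0] := eqVneq r 0; first by rewrite size_poly0.
  have : (size (q - q.[t]%:P)%R <= D.+2)%N.
    rewrite (leq_trans (size_polyD _ _))// size_polyN geq_max sq.
    by rewrite (leq_trans (size_polyC_leq1 _)).
  by rewrite qr size_Mmonic ?monicXsubC// size_XsubC addn2.
have qD : q`_D.+1 = r`_D.
  have : (q - q.[t]%:P)`_D.+1 = (r * ('X - t%:P))`_D.+1 by rewrite qr.
  rewrite coefB coefC subr0 => ->.
  by rewrite mulrBr coefB coefMX coefMC/= [r`_D.+1]nth_default ?mul0r ?subr0.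
rewrite qD exprS mulrA; apply: (IHD r _ ts) => // t' t'ts.
have st' : s <= `|t' - t| by rewrite distrC; move/allP: t_far; exact.
have : `|q.[t'] - q.[t]| <= eta + eta.
  by rewrite (le_trans (ler_normB _ _))// lerD// small// ?mem_head// in_cons t'ts orbT.
have -> : q.[t'] - q.[t] = r.[t'] * (t' - t).
  have : (q - q.[t]%:P).[t'] = (r * ('X - t%:P)).[t'] by rewrite qr.
  by rewrite !hornerE.
rewrite normrM => le2eta; rewrite mulrA ler_pdivlMr// mulr_natr mulr2n.
by apply: le_trans le2eta; exact: ler_wpM2l.
Qed.

Lemma card_small_values (R : realType) (D N : nat) (q : {poly R}) (s eta tau : R) :
  0 < s -> (size q <= D.+1)%N -> eta * (2 / s) ^+ D < `|q`_D| ->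
  (#|[pred j : 'I_N | (`|q.[tau + s * j%:R]| <= eta)%R]| <= D)%N.
Proof.
move=> s0 sq; rewrite ltNge; apply: contraNleq => D_lt.
set A := [pred j : 'I_N | `|q.[tau + s * j%:R]| <= eta] in D_lt.
pose pt (j : 'I_N) := tau + s * (nat_of_ord j)%:R.
apply: (coef_le_of_spread (ts := take D.+1 (map pt (enum A)))) => //.
- by rewrite size_takel// size_map -cardE.
- apply: (subseq_pairwise (take_subseq _ _)).
  rewrite pairwise_map; have := enum_uniq A; rewrite uniq_pairwise.
  apply: sub_pairwise => i j /= ij; rewrite /pt opprD addrACA subrr add0r -mulrBr.
  rewrite normrM gtr0_norm// ler_peMr// ?(ltW s0)//.
  wlog ji : i j ij / (j <= i)%N.
    by move=> H; case/orP: (leq_total i j) => ?; [rewrite distrC|];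
      apply: H => //; rewrite eq_sym.
  rewrite -natrB// normr_nat ler1n subn_gt0 ltn_neqAle ji andbT.
  by apply: contra_neq ij => /val_inj.
- by move=> t /mem_take/mapP[j]; rewrite mem_enum inE => + ->.
Qed.

Definition grid_point (R : realType) (n N : nat) (tau : 'cV[R]_n) (s : R)
    (j : 'cV['I_N]_n) : 'cV[R]_n := \col_i (tau i 0 + s * (j i 0)%:R).

Lemma card_cV_recl (n N : nat) (bad : pred 'cV['I_N]_(1 + n)) :
  #|bad| = \sum_(j : 'cV['I_N]_n) #|[pred a | bad (col_mx (const_mx a) j)]|.
Proof.
pose glue (p : 'cV['I_N]_n * 'I_N) := col_mx (const_mx p.2 : 'cV_1) p.1.
have glue_bij : bijective glue.
  exists (fun j => (dsubmx j, usubmx j 0 0)) => [[j a]|j]; rewrite /glue /=.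
    by rewrite col_mxKd col_mxKu mxE.
  rewrite -[RHS]vsubmxK; congr col_mx.
  by apply/matrixP => i k; rewrite !mxE !ord1.
rewrite -sum1_card (reindex glue)/=; last exact: onW_bij.
under [RHS]eq_bigr do rewrite -sum1_card.
by rewrite pair_big_dep /=; apply: eq_bigl => -[j a].
Qed.

(** A Schwartz-Zippel lemma for small values, uniform in the position tau of the
grid.  Let D be the largest degree in the first variable whose coefficient a_D is
not identically zero.  By induction, few grid points project to a point where a_D
is small.  Over any other projection, the polynomial in the first variable has a
large coefficient of degree D, so it is small at no more than D points.  The
factor N stands on the left-hand side so that the bound O(N^(n-1)) also makes
sense for n = 0. *)
Lemma grid_sparse (R : realType) (n : nat) (f : 'cV[R]_n -> R) :
  polyfun f -> (exists x, f x != 0) ->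
  exists C : nat, forall s : R, 0 < s -> exists2 eta : R, 0 < eta &
  forall (tau : 'cV[R]_n) (N : nat),
    (#|[pred j : 'cV['I_N]_n | (`|f (grid_point tau s j)| <= eta)%R]| * N
       <= C * N ^ n)%N.
Proof.
elim: n f => [f _ [x fx]|n IHn f].
  exists 0%N => s s0; exists (`|f x| / 2); first by rewrite divr_gt0 ?normr_gt0.
  move=> tau N; rewrite mul0n leqn0 muln_eq0; apply/orP; left.
  apply/eqP/eq_card0 => j; rewrite !inE [grid_point _ _ _]flatmx0 -(flatmx0 x).
  by apply/negbTE; rewrite -ltNge ltr_pdivrMr// ltr_pMr ?normr_gt0// ltr1n.
rewrite -[n.+1]/(1 + n)%N in f *; move=> pf [x0 fx0].
pose u (i : 'I_(1 + n)) (x : 'cV[R]_n) (t : R) : R :=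
  match fintype.split i with inl _ => t | inr k => x k 0 end.
have uE (x : 'cV[R]_n) t : \col_i u i x t = col_mx (t%:M : 'cV_1) x.
  apply/colP => i; rewrite mxE /u.
  by case: split_ordP => k ->; rewrite ?col_mxEu ?col_mxEd// ord1 mxE.
have [P [M [pP sP fP]]] : poly_family (fun x t => f (\col_i u i x t)).
  apply: poly_family_comp => // i; rewrite /u; case: (fintype.split i) => k.
    exact: poly_family_var.
  exact/poly_family_cst/polyfun_coord.
(* D is the largest exponent of the first variable whose coefficient does not
   vanish identically. *)
pose nonzero k := `[< exists x, (P x)`_k != 0 >].
have nonzero_ex : exists k, nonzero k.
  apply: contrapT => none; move/negP: fx0; apply.
  have -> : x0 = \col_i u i (dsubmx x0) (usubmx x0 0 0).
    by rewrite uE -[LHS]vsubmxK; congr col_mx; apply/matrixP => i k; rewrite !ord1 !mxE.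
  rewrite fP; suff -> : P (dsubmx x0) = 0 by rewrite horner0.
  apply/polyP => k; rewrite coef0; apply/eqP/negPn/negP => Pk.
  by apply: none; exists k; apply/asboolP; exists (dsubmx x0).
have nonzero_lt k : nonzero k -> (k <= M)%N.
  move=> /asboolP[x]; apply: contraNleq => Mk.
  by rewrite nth_default// (leq_trans (sP x))// ltnW.
case: (ex_maxnP nonzero_ex nonzero_lt) => D /asboolP nzD maxD.
have sD x : (size (P x) <= D.+1)%N.
  apply/leq_sizeP => k Dk; apply/eqP/negPn/negP => Pk.
  by have := maxD k; rewrite leqNgt Dk => /(_ _)/notF; apply; apply/asboolP; exists x.
have [C HC] := IHn _ (pP D) nzD.
exists (C + D)%N => s s0; have [eta eta0 small] := HC s s0.
have s2D : 0 < (2 / s) ^+ D by rewrite exprn_gt0// divr_gt0.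
(* With this threshold the divided difference estimate bounds the coefficient of
   degree D by eta. *)
exists (eta / (2 / s) ^+ D); first exact: divr_gt0.
move=> tau N; rewrite card_cV_recl.
pose smallD (j : 'cV['I_N]_n) := `|(P (grid_point (dsubmx tau) s j))`_D| <= eta.
apply: (@leq_trans ((\sum_(j : 'cV['I_N]_n) (smallD j * N + D)) * N)).
  rewrite leq_mul2r; apply/orP; right; apply: leq_sum => j _.
  have [js|js] := boolP (smallD j).
    by rewrite mul1n (leq_trans (max_card _))// card_ord leq_addr.
  rewrite mul0n add0n.
  rewrite (@leq_trans _ _ _ _ (@card_small_values _ D N (P (grid_point (dsubmx tau) s j))
    s (eta / (2 / s) ^+ D) (tau (lshift n 0) 0) s0 (sD _) _))//; last first.
    by rewrite divfK ?gt_eqF// ltNge.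
  apply/subset_leq_card/fintype.subsetP => a; rewrite !inE -fP uE.
  congr (`|f _| <= _); apply/colP => i; rewrite mxE.
  case: (split_ordP i) => k ->; rewrite ?col_mxEu ?col_mxEd !mxE //.
  by rewrite !ord1 mulr1n.
rewrite big_split/= sum_nat_const card_mx card_ord muln1 -big_distrl/= mulnDl.
rewrite mulnDl leq_add//; last by rewrite expnS [(N * _)%N]mulnC mulnA [(_ * D)%N]mulnC.
rewrite expnS mulnCA [leqRHS]mulnC leq_mul2r; apply/orP; right.
apply: leq_trans (small (dsubmx tau) N); rewrite leq_mul2r; apply/orP; right.
rewrite -sum1_card [leqRHS]big_mkcond/=; apply: leq_sum => j _.
by rewrite inE -/(smallD j); case: (smallD j).
Qed.

(** The bound on f is carried along for the case of products. *)
Lemma polyfun_lipschitz (R : realType) (n : nat) (f : 'cV[R]_n -> R) (M : R) :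
  polyfun f -> exists B L : R,
  [/\ forall x : 'cV[R]_n, (forall i, `|x i 0| <= M) -> `|f x| <= B &
      forall (x y : 'cV[R]_n) (e : R),
        (forall i, `|x i 0| <= M) -> (forall i, `|y i 0| <= M) ->
        (forall i, `|x i 0 - y i 0| <= e) -> `|f x - f y| <= L * e].
Proof.
elim=> [c|i|g h _ [Bg [Lg [gB gL]]] _ [Bh [Lh [hB hL]]]
  |g h _ [Bg [Lg [gB gL]]] _ [Bh [Lh [hB hL]]]].
- by exists `|c|, 0; split=> // x y e _ _ _; rewrite subrr normr0 mul0r.
- by exists M, 1; split=> // x y e _ _ xy; rewrite mul1r.
- exists (Bg + Bh), (Lg + Lh); split=> [x xM|x y e xM yM xy].
    by rewrite (le_trans (ler_normD _ _))// lerD ?gB ?hB.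
  by rewrite opprD addrACA (le_trans (ler_normD _ _))// mulrDl lerD ?gL ?hL.
- exists (Bg * Bh), (Bg * Lh + Bh * Lg); split=> [x xM|x y e xM yM xy].
    by rewrite normrM ler_pM ?gB ?hB.
  have -> : g x * h x - g y * h y = g x * (h x - h y) + h y * (g x - g y) by ring.
  rewrite (le_trans (ler_normD _ _))// !normrM mulrDl -!mulrA lerD//.
    by rewrite ler_pM ?gB ?hL.
  by rewrite ler_pM ?hB ?gL.
Qed.

Lemma mem_cell (R : realType) (N : nat) (s t : R) :
  0 < s -> 0 <= t < s * N%:R -> exists j : 'I_N, s * j%:R <= t < s * j%:R + s.
Proof.
move=> s0 /andP[t0 tN].
have /andP[jt tj] : (Num.truncn (t / s))%:R <= t / s < (Num.truncn (t / s)).+1%:R.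
  by apply: truncn_itv; rewrite divr_ge0// ltW.
have jN : (Num.truncn (t / s) < N)%N.
  by rewrite -(ltr_nat R) (le_lt_trans jt)// ltr_pdivrMr// mulrC.
exists (Ordinal jN) => /=.
by move: jt tj; rewrite ler_pdivlMr// ltr_pdivrMr// -natr1 mulrDl mul1r
  [_ * s]mulrC => -> ->.
Qed.

(** A cube [-M, M]^n is cut into cells of side w = s / K.  Their lower corners form
the union of the translates, by w r with r in {0..K-1}^n, of one grid of spacing
s = 2 M / N.  By the Lipschitz bound, f is small at the corner of any cell that
meets its zero set, so by [grid_sparse] these cells number at most
K^n C N^(n-1), and their volume is at most C (2 M)^n / N. *)
Lemma lebesgue_null_zeros (R : realType) (n : nat) (f : 'cV[R]_n -> R) :
  polyfun f -> (exists x, f x != 0) -> lebesgue_null [set x | f x = 0].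
Proof.
move=> pf fx0.
pose cube (M : nat) := [set x : 'cV[R]_n | forall i, `|x i 0| < M.+1%:R].
apply: (@lebesgue_null_sub _ _ _ (\bigcup_M ([set x | f x = 0] `&` cube M))).
  move=> x fx; exists (Num.bound `|x|) => //; split=> // i.
  apply: (@le_lt_trans _ _ `|x|); last first.
    by rewrite (lt_le_trans (archi_boundP _))// ler_nat.
  rewrite [leRHS]/Num.norm/= mx_normrE.
  exact: (le_bigmax _ (fun ij : 'I_n * 'I_1 => `|x ij.1 ij.2|) (i, 0)).
apply: lebesgue_null_bigcup_nat => M'; set M : R := M'.+1%:R.
have M0 : 0 < M by rewrite ltr0n.
apply: lebesgue_null_countable_cover => e e0.
have [C sparse] := grid_sparse pf fx0.
have [_ [L [_ fL]]] := polyfun_lipschitz M pf.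
(* N makes the final volume C (2 M)^n / N smaller than e. *)
pose N := (Num.bound (C%:R * (M *+ 2) ^+ n / e)).+1.
have NC : C%:R * (M *+ 2) ^+ n <= e * N%:R.
  rewrite [leRHS]mulrC -ler_pdivrMr// ltW// (lt_le_trans (archi_boundP _)) ?ler_nat//.
  by rewrite divr_ge0 ?mulr_ge0 ?exprn_ge0 ?ler0n ?mulrn_wge0// ltW.
pose s := M *+ 2 / N%:R.
have s0 : 0 < s by rewrite divr_gt0 ?pmulrn_lgt0 ?ltr0n.
have [eta eta0 small] := sparse s s0.
(* K makes the variation of f on a cell smaller than eta. *)
pose K := (Num.bound (`|L| * s / eta)).+1.
pose w := s / K%:R.
have w0 : 0 < w by rewrite divr_gt0 ?ltr0n.
have Lw : L * w <= eta.
  rewrite /w mulrA ler_pdivrMr ?ltr0n// [leRHS]mulrC -ler_pdivrMr//.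
  rewrite (@le_trans _ _ (`|L| * s / eta))//.
    by rewrite ler_pM2r ?invr_gt0// ler_pM2r// ler_norm.
  rewrite ltW// (lt_le_trans (archi_boundP _)) ?ler_nat//.
  by apply: divr_ge0; [apply: mulr_ge0|]; rewrite ?normr_ge0// ltW.
pose corner (p : 'cV['I_K]_n * 'cV['I_N]_n) :=
  grid_point (grid_point (const_mx (- M)) w p.1) s p.2.
pose bad (p : 'cV['I_K]_n * 'cV['I_N]_n) := `|f (corner p)| <= eta.
exists ('cV['I_K]_n * 'cV['I_N]_n)%type, [set p | bad p], corner,
  (fun p => corner p + const_mx w); split.
- by move=> p i; rewrite [(_ + const_mx _) _ _]mxE [const_mx w _ _]mxE lerDl ltW.
- move=> x [/= fx xM].
  have xE i : - M < x i 0 < M by rewrite -ltr_norml.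
  have cellj i : exists j : 'I_N, s * j%:R <= x i 0 + M < s * j%:R + s.
    apply: mem_cell => //; rewrite divfK ?pnatr_eq0//.
    by have := xE i; rewrite mulr2n; lra.
  have [j jP] := choice cellj.
  have cellr i : exists r : 'I_K, w * r%:R <= x i 0 + M - s * (j i)%:R < w * r%:R + w.
    apply: mem_cell => //; rewrite divfK ?pnatr_eq0//.
    by have := jP i; lra.
  have [r rP] := choice cellr.
  pose p : 'cV['I_K]_n * 'cV['I_N]_n := (\col_i r i, \col_i j i).
  have pE i : corner p i 0 = - M + w * (r i)%:R + s * (j i)%:R by rewrite !mxE.
  exists p; last first.
    move=> i; rewrite [(_ + const_mx _) _ _]mxE [const_mx w _ _]mxE pE.
    by have := rP i; lra.
  rewrite /= /bad -[f (corner p)]subr0 -[X in _ - X]fx (le_trans _ Lw)// fL//.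
  + move=> i; rewrite pE ler_norml; have := xE i; have := rP i; have := jP i.
    have : 0 <= w * (r i)%:R by rewrite mulr_ge0// ltW.
    have : 0 <= s * (j i)%:R by rewrite mulr_ge0// ltW.
    by lra.
  + by move=> i; exact: ltW.
  + by move=> i; rewrite pE ler_norml; have := rP i; lra.
- have vol p : box_volume (corner p) (corner p + const_mx w) = w ^+ n.
    rewrite /box_volume (eq_bigr (fun=> w)) ?prodr_const ?card_ord// => i _.
    by rewrite [(_ + const_mx _) _ _]mxE [const_mx w _ _]mxE addrAC subrr add0r.
  rewrite (eq_esum (b := fun=> (w ^+ n)%:E)); last by move=> p _; rewrite vol.
  have -> : [set p | bad p] = [set` enum bad].
    by apply/seteqP; split=> p /=; rewrite mem_enum.
  rewrite esum_fset ?finite_seqP; [|by exists (enum bad)|]; last first.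
    by move=> p _; rewrite lee_fin exprn_ge0// ltW.
  rewrite -fsbig_seq ?enum_uniq//= sumEFin lee_fin big_const_seq count_predT -cardE.
  have bad_le : (#|bad| * N <= K ^ n * (C * N ^ n))%N.
    have -> : #|bad| = (\sum_(r : 'cV['I_K]_n) #|[pred j | bad (r, j)]|)%N.
      rewrite -sum1_card; under [RHS]eq_bigr do rewrite -sum1_card.
      by rewrite pair_big_dep/=; apply: eq_bigl => -[r j].
    rewrite big_distrl/= -[(K ^ n)%N]mul1n.
    have -> : (1 * K ^ n)%N = #|{: 'cV['I_K]_n}| by rewrite card_mx card_ord muln1 mul1n.
    by rewrite -sum_nat_const; apply: leq_sum => r _;
      exact: (small (grid_point (const_mx (- M)) w r) N).
  rewrite iter_addr_0 -mulr_natr -(ler_pM2r (_ : 0 < N%:R)) ?ltr0n// (le_trans _ NC)//.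
  rewrite -mulrA -natrM; apply: (@le_trans _ _ (w ^+ n * (K ^ n * (C * N ^ n))%:R)).
    by rewrite ler_pM2l ?exprn_gt0// ler_nat.
  rewrite !natrM !natrX mulrA -exprMn /w divfK ?pnatr_eq0// mulrCA -exprMn.
  by rewrite /s divfK ?pnatr_eq0.
Qed.

(** * Calculus of polynomial functions *)

Lemma polyfun_continuous (R : realType) (n : nat) (f : 'cV[R]_n -> R) :
  polyfun f -> continuous f.
Proof.
elim=> [c x|i x|g h _ cg _ ch x|g h _ cg _ ch x].
- exact: cst_continuous.
- exact: coord_continuous.
- exact: (cvgD (cg x) (ch x)).
- exact: (cvgM (cg x) (ch x)).
Qed.

Lemma polyfun_differentiable (R : realType) (n : nat) (f : 'cV[R]_n -> R) x :
  polyfun f -> differentiable f x.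
Proof.
elim=> [c|i|g h _ dg _ dh|g h _ dg _ dh].
- exact: differentiable_cst.
- exact: differentiable_coord.
- exact: differentiableD.
- exact: differentiableM.
Qed.

Lemma polyfun_derivable (R : realType) (n : nat) (f : 'cV[R]_n -> R) x v :
  polyfun f -> derivable f x v.
Proof. by move=> pf; apply/diff_derivable/polyfun_differentiable. Qed.

Lemma polyfun_derive (R : realType) (n : nat) (f : 'cV[R]_n -> R) v :
  polyfun f -> polyfun (fun x => 'D_v f x).
Proof.
elim=> [c|i|g h pg dg ph dh|g h pg dg ph dh].
- by apply: eq_polyfun (polyfun_cst _ 0) => x; rewrite derive_cst.
- apply: eq_polyfun (polyfun_cst _ (v i 0)) => x; apply/esym/cvg_lim => //.
  apply: cvg_near_cst; near=> h => /=.
  rewrite !mxE addrK [_ *: _]mulrA mulVf ?mul1r//; near: h; exact: nbhs_dnbhs_neq.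
- apply: eq_polyfun (polyfunD dg dh) => x.
  by rewrite deriveD//; exact: polyfun_derivable.
- apply: eq_polyfun (polyfunD (polyfunM pg dh) (polyfunM ph dg)) => x.
  by rewrite deriveM//; exact: polyfun_derivable.
Unshelve. all: by end_near. Qed.

Lemma polyfun_derive_grad (R : realType) (n : nat) (f : 'cV[R]_n -> R) x v :
  polyfun f -> 'D_v f x = \sum_i v i 0 * grad f x i 0.
Proof.
move=> pf; have df := polyfun_differentiable x pf.
rewrite deriveE// [in LHS](matrix_sum_delta v).
rewrite linear_sum; apply: eq_bigr => i _.
rewrite big_ord1 linearZ/= mxE deriveE//.
Qed.

Lemma polyfun_diff_quotient (R : realType) (n : nat) (f : 'cV[R]_n -> R) x v :
  polyfun f ->
  (f (x + delta *: v) - f x) / delta @[delta --> 0^'+]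
    --> \sum_i v i 0 * grad f x i 0.
Proof.
move=> pf; rewrite -polyfun_derive_grad//.
have -> : (fun delta : R => (f (x + delta *: v) - f x) / delta) =
    (fun delta => delta^-1 *: (f (delta *: v + x) - f x)).
  by apply/funext => delta; rewrite [x + _]addrC mulrC.
by apply: cvg_dnbhs_at_right; exact: polyfun_derivable.
Qed.

(** Let k be the smallest exponent of t whose coefficient a_k does not vanish
identically.  Then F v t = t^k H(v, t) with H continuous and H(v, 0) = a_k(v), so
for t > 0 the sign of F near (v, 0) is that of a_k(v) unless a_k(v) = 0. *)
Lemma poly_family_sign_near (R : realType) (n : nat) (F : 'cV[R]_n -> R -> R) :
  poly_family F ->
  lebesgue_null [set v | ~ exists b : bool, \forall w \near (v, 0 : R),
    0 < w.2 -> (0 <= F w.1 w.2) = b].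
Proof.
move=> [P [N [pP sP FP]]].
have [nonzero_ex|none] := pselect (exists k, `[< exists v, (P v)`_k != 0 >]); last first.
  apply: (@lebesgue_null_sub _ _ _ set0); last exact: lebesgue_null0.
  move=> v /=; apply; exists true; near=> w => _.
  suff P0 : P w.1 = 0 by rewrite FP P0 horner0 lexx.
  apply/polyP => k; rewrite coef0; apply/eqP/negPn/negP => Pk.
  by apply: none; exists k; apply/asboolP; exists w.1.
case: (ex_minnP nonzero_ex) => k /asboolP nzk mink.
have lowP v j : (j < k)%N -> (P v)`_j = 0.
  move=> jk; apply/eqP/negPn/negP => Pj.
  by have := mink j; rewrite leqNgt jk => /(_ _)/notF; apply; apply/asboolP; exists v.
pose H (w : 'cV[R]_n * R) := \sum_(i < N) (P w.1)`_(k + i) * w.2 ^+ i.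
have FH v t : F v t = t ^+ k * H (v, t).
  rewrite FP -(poly_take_drop k (P v)).
  rewrite (_ : take_poly k (P v) = 0) ?add0r; last first.
    by apply/polyP => j; rewrite coef_take_poly coef0; case: ifP => // /lowP ->.
  rewrite hornerM hornerXn mulrC; congr (_ * _).
  rewrite (@horner_coef_wide _ N) ?size_drop_poly ?(leq_trans (leq_subr _ _))//.
  by apply: eq_bigr => i _; rewrite coef_drop_poly addnC.
have H0 v : H (v, 0) = (P v)`_k.
  rewrite /H; case: N sP @H FH => [|N] sP H FH.
    by rewrite big_ord0 nth_default// (leq_trans (sP v)).
  rewrite big_ord_recl/= addn0 mulr1 big1 ?addr0// => i _.
  by rewrite expr0n mulr0.
have Hcont v : {for (v, 0), continuous H}.
  have term (i : 'I_N) :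
      {for (v, 0), continuous (fun w : 'cV[R]_n * R => (P w.1)`_(k + i) * w.2 ^+ i)}.
    have c1 : {for (v, 0), continuous (fun w : 'cV[R]_n * R => (P w.1)`_(k + i))}.
      apply: (@continuous_comp _ _ _ fst (fun v => (P v)`_(k + i))).
        exact: cvg_fst.
      exact: polyfun_continuous.
    have c2 : {for (v, 0), continuous (fun w : 'cV[R]_n * R => w.2 ^+ i)}.
      apply: (@continuous_comp _ _ _ snd (fun t : R => t ^+ i)).
        exact: cvg_snd.
      exact: exprn_continuous.
    exact: (continuousM c1 c2).
  by apply: cvg_big => [|i _]; [exact: add_continuous|exact: term].
apply: lebesgue_null_sub (lebesgue_null_zeros (pP k) nzk) => v /=.
apply: contra_notP => /eqP; rewrite neq_lt => /orP[Pv|Pv].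
  have := Hcont v [set y | y < 0]; rewrite H0 => /(_ (lt_nbhsl Pv)) Hneg.
  exists false; near=> w => w0.
  rewrite FH pmulr_rge0 ?exprn_gt0// -surjective_pairing; apply/negbTE.
  by rewrite -ltNge; near: w; exact: Hneg.
have := Hcont v [set y | 0 < y]; rewrite H0 => /(_ (lt_nbhsr Pv)) Hpos.
exists true; near=> w => w0.
rewrite FH pmulr_rge0 ?exprn_gt0// -surjective_pairing.
by apply: ltW; near: w; exact: Hpos.
Unshelve. all: by end_near. Qed.

(** * Branches of a program *)

Lemma size_branch_values (R : realType) (d T : nat) (P : program R T)
    (z : signs T) (x : 'cV[R]_d) (n : nat) :
  size (branch_values P z x n) = (d + n)%N.
Proof.
elim: n => [|n IHn] /=; first by rewrite size_map size_enum_ord addn0.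
by rewrite size_rcons IHn addnS.
Qed.

Lemma branch_varE (R : realType) (d T : nat) (P : program R T)
    (z : signs T) (x : 'cV[R]_d) (n : nat) :
  branch_var P z (d + n) x =
  eval_step P (d + n) (signs_before z (d + n)) (branch_values P z x n).
Proof.
rewrite /branch_var -addnS addKn /= size_branch_values nth_rcons.
by rewrite size_branch_values ltnn eqxx.
Qed.

Lemma polyfun_eval_operation (R : realType) (d k : nat) (o : operation R k)
    (A : {set 'I_k}) (s : 'cV[R]_d -> seq R) :
  (forall j, polyfun (fun x => (s x)`_j)) ->
  polyfun (fun x => eval_operation o A (s x)).
Proof.
move=> ps; case: o => [c e|b a] /=.
  apply: polyfunM; first exact: polyfun_cst.
  by apply: polyfun_prod => j; exact: polyfunX.
apply: polyfunD; first exact: polyfun_cst.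
by apply: polyfun_sum => j; apply: polyfunM; [exact: polyfun_cst|].
Qed.

Lemma polyfun_branch_values (R : realType) (d T : nat) (P : program R T)
    (z : signs T) (n k : nat) :
  polyfun (fun x : 'cV[R]_d => (branch_values P z x n)`_k).
Proof.
elim: n k => [|n IHn] k /=.
  have [kd|dk] := ltnP k d.
    apply: eq_polyfun (polyfun_coord _ (Ordinal kd)) => x.
    rewrite /inputs (nth_map (Ordinal kd)) ?size_enum_ord//; congr (x _ 0).
    by apply/val_inj; rewrite /= nth_enum_ord.
  apply: eq_polyfun (polyfun_cst _ 0) => x.
  by rewrite nth_default// size_map size_enum_ord.
under eq_fun do rewrite nth_rcons size_branch_values.
case: ltngtP => _; [exact: IHn|exact: polyfun_cst|].
exact: polyfun_eval_operation.
Qed.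

Lemma polyfun_branch_output (R : realType) (d T : nat) (P : program R T)
    (z : signs T) : polyfun (@branch_output R d T P z).
Proof. exact: polyfun_branch_values. Qed.

Lemma polyfun_branch_constraint (R : realType) (d T : nat) (P : program R T)
    (z : signs T) (k : 'I_T) : polyfun (@branch_constraint R d T P z k).
Proof.
rewrite /branch_constraint; case: (_ && branches _ _ _); last exact: polyfun_cst.
exact: polyfun_branch_values.
Qed.

Lemma signs_before_trans (T : nat) (z z' : signs T) (j k : nat) :
  (j <= k)%N -> signs_before z k = signs_before z' k ->
  signs_before z j = signs_before z' j.
Proof.
move=> jk zz'; apply/ffunP => i; rewrite !ffunE; have [ij|//] := ltnP i j.
by have := congr1 (fun y : signs T => y i) zz'; rewrite !ffunE (leq_trans ij jk).
Qed.

Lemma branch_values_local (R : realType) (d T : nat) (P : program R T)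
    (z z' : signs T) (x : 'cV[R]_d) (k n : nat) :
  signs_before z k = signs_before z' k -> (d + n <= k.+1)%N ->
  branch_values P z x n = branch_values P z' x n.
Proof.
move=> zz'; elim: n => [//|n IHn]; rewrite addnS ltnS => dnk /=.
rewrite -IHn; last exact: leqW.
by rewrite size_branch_values (signs_before_trans dnk zz').
Qed.

(** Whether a step is reached along z is thus determined by the signs before it. *)
Lemma leq_halt_step (R : realType) (d T : nat) (P : program R T)
    (z : signs T) (n : nat) : (d + n <= T)%N ->
  (d + n <= halt_step d P z)%N =
  ~~ has (fun k => halts P k (signs_before z k.+1)) (iota d n).
Proof.
move=> dnT; rewrite /halt_step leq_add2l leqNgt -has_take_leq.
  rewrite take_iota; congr (~~ has _ (iota _ _)); apply/minn_idPl.
  by rewrite leq_subRL// (leq_trans (leq_addr _ _) dnT).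
by rewrite size_iota leq_subRL// (leq_trans (leq_addr _ _) dnT).
Qed.

Lemma branch_constraint_local (R : realType) (d T : nat) (P : program R T)
    (z z' : signs T) (x : 'cV[R]_d) (k : 'I_T) :
  signs_before z k = signs_before z' k ->
  branch_constraint P z k x = branch_constraint P z' k x.
Proof.
move=> zz'; rewrite /branch_constraint zz' /branch_var.
have [dk|//] := leqP d k.
have kE : val k = (d + (k - d))%N by rewrite subnKC.
rewrite (@branch_values_local _ _ _ _ z z' _ k)//; last by rewrite subnKC// leqW.
suff -> : (k <= halt_step d P z)%N = (k <= halt_step d P z')%N by [].
rewrite [in LHS]kE [in RHS]kE !leq_halt_step -?kE ?(ltnW (ltn_ord k))//.
congr (~~ _); apply: eq_in_has => j; rewrite mem_iota subnKC// => /andP[_ jk].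
by rewrite (signs_before_trans jk zz').
Qed.

(** As the k-th constraint only involves the signs before k, a consistent z is
found one sign at a time. *)
Lemma branch_set_cover (R : realType) (d T : nat) (P : program R T) (x : 'cV[R]_d) :
  exists z, branch_set P z x.
Proof.
suff H n : (n <= T)%N -> exists z : signs T,
    forall k : 'I_T, (k < n)%N -> (0 <= branch_constraint P z k x) = z k.
  by have [z zP] := H T (leqnn T); exists z => k; exact: zP.
elim: n => [|n IHn] nT; first by exists (minus_ones T).
have [z zP] := IHn (ltnW nT); pose kn := Ordinal nT.
pose z' := set_sign z n (0 <= branch_constraint P z kn x).
have before k : (k <= n)%N -> signs_before z' k = signs_before z k.
  move=> kn'; apply/ffunP => i; rewrite !ffunE; case: ltnP => //= ik.
  by rewrite ltn_eqF// (leq_trans ik).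
exists z' => k; rewrite ltnS => kn'; rewrite (branch_constraint_local _ _ (before _ kn')).
rewrite ffunE; case: eqVneq => [kE|kn_neq].
  by rewrite (_ : k = kn)//; exact/val_inj.
by rewrite zP// ltn_neqAle kn_neq.
Qed.

(** On the set of the branch z, the state of the run before step d + m consists of
the values along z and of the signs of z before that step. *)
Lemma run_from_branch (R : realType) (d T : nat) (P : program R T)
    (z : signs T) (x : 'cV[R]_d) (n m : nat) (r : R) :
  branch_set P z x -> (d + m + n)%N = T -> (d + m <= halt_step d P z)%N ->
  run_from P n (branch_values P z x m) (signs_before z (d + m)) = Some r ->
  r = branch_output P z x.
Proof.
move=> zx; elim: n m => [//|n IHn] m dmT dmz /=.
rewrite size_branch_values -branch_varE.
have dmltT : (d + m < T)%N by rewrite -dmT addnS ltnS leq_addr.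
have -> : (if branches P (d + m) (signs_before z (d + m))
    then set_sign (signs_before z (d + m)) (d + m) (0 <= branch_var P z (d + m) x)
    else signs_before z (d + m)) = signs_before z (d + m).+1.
  have := zx (Ordinal dmltT); rewrite /branch_constraint leq_addr dmz /= => zdm.
  have before i : i != d + m :> nat -> (i < d + m)%N = (i < (d + m).+1)%N.
    by move=> idm; rewrite ltnS ltn_neqAle idm.
  case: ifP zdm => /= _ zdm; apply/ffunP => i; rewrite !ffunE;
    have [idm|/before->//] := eqVneq (i : nat) (d + m)%N.
    by rewrite zdm idm leqnn/=; congr (z _); exact/val_inj.
  rewrite idm ltnn ltnSn/= (_ : i = Ordinal dmltT); last exact/val_inj.
  by rewrite -zdm ler0N1.
have haltS : (d + m.+1 <= halt_step d P z)%N =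
    (d + m <= halt_step d P z)%N && ~~ halts P (d + m) (signs_before z (d + m).+1).
  rewrite leq_halt_step ?addnS// leq_halt_step; last exact: ltnW.
  by rewrite -[in iota d m.+1]addn1 iotaD has_cat negb_or /= orbF.
case: ifP haltS => [_|halt] haltS.
  case=> <-; rewrite /branch_output; congr (branch_var _ _ _ _).
  by apply/eqP; rewrite eqn_leq dmz leqNgt/= -addnS haltS dmz.
move=> run; apply: (IHn m.+1); rewrite ?haltS ?dmz//.
  by rewrite -dmT !addnS addSn.
by rewrite addnS /= size_branch_values -branch_varE.
Qed.

Lemma branch_set_output (R : realType) (d T : nat) (P : program R T)
    (g : 'cV[R]_d -> R) (z : signs T) (x : 'cV[R]_d) :
  computes P g -> branch_set P z x -> g x = branch_output P z x.
Proof.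
move=> /(_ x) run_x zx; move: run_x; rewrite /run.
have [dT|Td] := leqP d T; last by rewrite (eqP (ltnW Td)).
move=> run_x; apply: (@run_from_branch _ _ _ P z x (T - d) 0) => //.
- by rewrite addn0 subnKC.
- by rewrite addn0 leq_addr.
- rewrite -run_x addn0; congr run_from; apply/ffunP => i; rewrite !ffunE.
  case: ltnP => //= id.
  by rewrite -(zx i) /branch_constraint leqNgt id/= ler0N1.
Qed.

(** * Thin cones around a ray *)

(** The pair (v', t) stands for the point x + t v', and a set of this filter for a
thin truncated cone with apex x around the ray of v.  The apex is excluded, since
the programs may take another branch there. *)
Definition cone (R : realType) (n : nat) (v : 'cV[R]_n) : set_system ('cV[R]_n * R) :=
  filter_prod (nbhs v) (0 : R)^'+.

#[local] Instance cone_filter (R : realType) (n : nat) (v : 'cV[R]_n) :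
  ProperFilter (cone v).
Proof. exact: filter_prod_proper. Qed.

Lemma cone_near_rays (R : realType) (n : nat) (v : 'cV[R]_n) (Q : 'cV[R]_n -> R -> Prop) :
  (\forall w \near cone v, Q w.1 w.2) ->
  \forall v' \near v, \forall t \near 0^'+, Q v' t.
Proof. exact: (@nearP_dep _ _ (nbhs v) (0 : R)^'+ _ _ Q). Qed.

Lemma cone_near_ray (R : realType) (n : nat) (v : 'cV[R]_n) (Q : 'cV[R]_n -> R -> Prop) :
  (\forall w \near cone v, Q w.1 w.2) -> \forall t \near 0^'+, Q v t.
Proof. by move=> /cone_near_rays/nbhs_singleton. Qed.

(** A thin cone contains a neighbourhood of each point of its axis, because
y |-> (y - x) / t is continuous. *)
Lemma cone_near_points (R : realType) (n : nat) (x v : 'cV[R]_n) (Q : 'cV[R]_n -> Prop) :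
  (\forall w \near cone v, Q (x + w.2 *: w.1)) ->
  \forall t \near 0^'+, \forall y \near x + t *: v, Q y.
Proof.
move=> [[A B] /= [vA tB] ABQ]; near=> t.
have t0 : 0 < t by near: t; exact: nbhs_right_gt.
have Bt : B t by near: t.
have : (fun y => t^-1 *: (y - x)) y @[y --> x + t *: v] --> v.
  rewrite -[X in _ --> X](_ : t^-1 *: (x + t *: v - x) = v); last first.
    by rewrite addrAC subrr add0r scalerA mulVf ?scale1r// gt_eqF.
  exact: (cvgZ (cvg_cst _) (cvgB cvg_id (cvg_cst _))).
move=> /(_ A vA) yA; near=> y.
have Ay : A (t^-1 *: (y - x)) by near: y.
have := ABQ (t^-1 *: (y - x), t) (conj Ay Bt).
by rewrite /= scalerA mulfV ?gt_eqF// scale1r addrC subrK.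
Unshelve. all: by end_near. Qed.

Lemma cone_near (R : realType) (n : nat) (v : 'cV[R]_n) (Q : 'cV[R]_n -> R -> Prop) :
  (\forall w \near (v, 0 : R), 0 < w.2 -> Q w.1 w.2) ->
  \forall w \near cone v, Q w.1 w.2.
Proof.
move=> [[A B] /= [vA tB] ABQ]; exists (A, [set t | 0 < t /\ B t]).
  by split=> //=; apply: filterS tB => t Bt t0; split.
by move=> [v' t] /= [Av' [t0 Bt]]; exact: (ABQ (v', t)).
Qed.

Lemma cvg_cV (R : realType) (n : nat) (T : Type) (F : set_system T)
    (f : T -> 'cV[R]_n) (l : 'cV[R]_n) : Filter F ->
  (forall i, f t i 0 @[t --> F] --> l i 0) -> f t @[t --> F] --> l.
Proof.
move=> FF fl; apply/cvgrPdist_le => e e0; near=> t.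
rewrite /Num.norm/= mx_normrE; apply: bigmax_le; first exact: ltW.
move=> [i j] _; rewrite /= ord1 !mxE; move: i.
near: t; apply: filter_forall => i.
by have /cvgrPdist_le := fl i; apply.
Unshelve. all: by end_near. Qed.

Lemma cvg_ray (R : realType) (n : nat) (x v : 'cV[R]_n) :
  x + t *: v @[t --> (0 : R)^'+] --> x.
Proof.
have id0 : (t : R) @[t --> (0 : R)^'+] --> (0 : R) by apply: cvg_within.
rewrite -[X in _ --> X]addr0 -[X in _ + X](scale0r v).
exact: (cvgD (cvg_cst x) (cvgZ id0 (cvg_cst v))).
Qed.

Lemma locally_lipschitz_bound (R : realType) (n : nat) (phi : 'cV[R]_n -> R)
    (x : 'cV[R]_n) :
  locally_lipschitz phi -> exists2 U : set 'cV[R]_n, nbhs x U &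
    exists2 L : R, 0 < L & forall a b, U a -> U b -> `|phi a - phi b| <= L * `|a - b|.
Proof.
move=> /(_ x)[U xU phiU]; exists U => //.
have [L [_ LU]] := phiU; exists (`|L| + 1); first by rewrite ltr_wpDl.
have L1 : L < `|L| + 1 by rewrite (le_lt_trans (ler_norm _))// ltrDl.
by move=> a b Ua Ub; exact: (LU _ L1 (a, b) (conj Ua Ub)).
Qed.

Lemma locally_lipschitz_continuous (R : realType) (n : nat) (phi : 'cV[R]_n -> R) :
  locally_lipschitz phi -> continuous phi.
Proof.
move=> lphi x; have [U xU [L L0 phiL]] := locally_lipschitz_bound x lphi.
apply/(@cvgrPdist_le _ _ _ (nbhs x) (nbhs_filter x)) => e e0; near=> y.
apply: (le_trans (phiL _ _ _ _)); first exact: nbhs_singleton.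
  by near: y.
rewrite mulrC -ler_pdivlMr//; near: y.
by apply: cvgr_dist_le => //; exact: divr_gt0.
Unshelve. all: by end_near. Qed.

(** The curve differs from its tangent ray by o(t), hence so do the values of phi.
This is what allows the curve and its tangent ray to run through different pieces
of phi. *)
Lemma lipschitz_chain_quotient (R : realType) (n : nat) (phi : 'cV[R]_n -> R)
    (gamma : R -> 'cV[R]_n) (y w : 'cV[R]_n) (l : R) :
  locally_lipschitz phi ->
  t^-1 *: (gamma t - y) @[t --> 0^'+] --> w ->
  (phi (y + t *: w) - phi y) / t @[t --> 0^'+] --> l ->
  (phi (gamma t) - phi y) / t @[t --> 0^'+] --> l.
Proof.
move=> lphi gammaw phil.
have [U yU [L L0 phiL]] := locally_lipschitz_bound y lphi.
have id0 : (t : R) @[t --> (0 : R)^'+] --> (0 : R).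
  by apply: cvg_within.
have gamma_y : gamma t @[t --> 0^'+] --> y.
  rewrite -[X in _ --> X]addr0 -[X in _ + X](scale0r w).
  apply: cvg_trans (cvgD (cvg_cst y) (cvgZ id0 gammaw)).
  apply: near_eq_cvg; near=> t; have t0 : 0 < t by near: t; exact: nbhs_right_gt.
  rewrite -[LHS]/(y + t *: (t^-1 *: (gamma t - y))).
  by rewrite scalerA mulfV ?gt_eqF// scale1r addrC subrK.
rewrite -[l]add0r.
have -> : (fun t => (phi (gamma t) - phi y) / t) =
    (fun t => (phi (gamma t) - phi (y + t *: w)) / t + (phi (y + t *: w) - phi y) / t).
  by apply/funext => t; rewrite -mulrDl addrA subrK.
apply: cvgD => //; apply/cvgr0Pnorm_le => e e0; near=> t.
have t0 : 0 < t by near: t; exact: nbhs_right_gt.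
rewrite normrM normfV (gtr0_norm t0) ler_pdivrMr//.
apply: (le_trans (phiL _ _ _ _)).
- by near: t; exact: gamma_y.
- by near: t; exact: cvg_ray.
have -> : gamma t - (y + t *: w) = t *: (t^-1 *: (gamma t - y) - w).
  by rewrite scalerBr scalerA mulfV ?gt_eqF// scale1r opprD addrA.
rewrite normrZ (gtr0_norm t0) mulrCA mulrC ler_pM2r// mulrC -ler_pdivlMr//.
rewrite distrC; near: t; apply: cvgr_dist_le => //; exact: divr_gt0.
Unshelve. all: by end_near. Qed.

(** Agreement on the open ray extends to its origin by continuity. *)
Lemma near_ray_quotient (R : realType) (n : nat) (phi q : 'cV[R]_n -> R)
    (x v : 'cV[R]_n) :
  {for x, continuous phi} -> polyfun q ->
  (\forall t \near 0^'+, phi (x + t *: v) = q (x + t *: v)) ->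
  (phi (x + t *: v) - phi x) / t @[t --> 0^'+] --> \sum_i v i 0 * grad q x i 0.
Proof.
move=> cphi pq phiq.
have line_x := @cvg_ray _ _ x v.
have phix : phi x = q x.
  have c1 := cvg_comp _ _ line_x cphi.
  have c2 : (phi \o (fun t : R => x + t *: v)) t @[t --> 0^'+] --> q x.
    apply: cvg_trans (cvg_comp _ _ line_x (polyfun_continuous pq (x := x))).
    by apply: near_eq_cvg; near=> t; apply/esym; near: t; exact: phiq.
  exact: (cvg_unique _ c1 c2).
have quot := @polyfun_diff_quotient _ _ q x v pq.
apply: (cvg_trans _ quot).
apply: near_eq_cvg; near=> t; congr ((_ - _) / _); last exact/esym.
by apply/esym; near: t; exact: phiq.
Unshelve. all: by end_near. Qed.

Lemma grad_continuous (R : realType) (n : nat) (q : 'cV[R]_n -> R) :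
  polyfun q -> continuous (grad q).
Proof.
move=> pq x; apply: (@cvg_cV _ _ _ (nbhs x) _ _ (nbhs_filter x)) => i; rewrite mxE.
under eq_cvg do rewrite mxE.
exact: (polyfun_continuous (polyfun_derive _ pq)).
Qed.

Lemma near_eq_differentiable (R : realType) (V : normedModType R) (f g : V -> R) (x : V) :
  (\forall y \near x, f y = g y) -> differentiable f x -> differentiable g x.
Proof.
move=> fg df.
have dg : g \o shift x = cst (g x) + 'd f x +o_ 0 id.
  apply/eqaddoP => e e0.
  have /eqaddoP/(_ e e0) := diff_locally df.
  have fg0 : \forall h \near (0 : V), f (h + x) = g (h + x).
    by have := fg; rewrite (near_shift 0) subr0.
  apply: filterS2 fg0 => h fgh.
  have -> // : (g \o shift x - (cst (g x) + 'd f x)) h =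
    (f \o shift x - (cst (f x) + 'd f x)) h.
  by rewrite -[LHS]/(g (h + x) - (g x + 'd f x h)) -fgh -(nbhs_singleton fg).
have dE : 'd g x = 'd f x :> (V -> R) by apply: diff_unique dg; exact: diff_continuous.
by apply/diff_locallyP; rewrite dE; split=> //; exact: diff_continuous.
Qed.

(** Agreement on a thin cone is agreement near every point of its axis, so phi and q
have the same gradients there. *)
Lemma cone_limder (R : realType) (n : nat) (phi q : 'cV[R]_n -> R)
    (x v : 'cV[R]_n) :
  polyfun q -> (\forall w \near cone v, phi (x + w.2 *: w.1) = q (x + w.2 *: w.1)) ->
  is_limder phi v x (grad q x).
Proof.
move=> pq coneq.
have phiq := cone_near_points (Q := fun y => phi y = q y) coneq; split.
  apply: filterS phiq => t phiq.
  apply: near_eq_differentiable (polyfun_differentiable _ pq).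
  by apply: filterS phiq => y /esym.
apply: cvg_trans (cvg_comp _ _ (@cvg_ray _ _ x v) (grad_continuous pq (x := x))).
apply: near_eq_cvg; apply: filterS phiq => t phiq.
apply/colP => i; rewrite !mxE; apply: near_eq_derive.
by apply: filterS phiq.
Qed.

(** * Settled branches *)

Definition poly_path (R : realType) (d n : nat) (u : 'cV[R]_d -> R -> 'cV[R]_n) : Prop :=
  forall i, poly_family (fun v t => u v t i 0).

Lemma poly_path_comp (R : realType) (d n : nat) (f : 'cV[R]_n -> R)
    (u : 'cV[R]_d -> R -> 'cV[R]_n) :
  polyfun f -> poly_path u -> poly_family (fun v t => f (u v t)).
Proof.
move=> pf pu; have := poly_family_comp pf pu.
congr poly_family; apply/funext => v; apply/funext => t; congr f.
by apply/colP => i; rewrite mxE.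
Qed.

Lemma poly_path_ray (R : realType) (d n : nat) (y : 'cV[R]_n) (J : 'M[R]_(n, d)) :
  poly_path (fun (v : 'cV[R]_d) t => y + t *: (J *m v)).
Proof.
move=> i; rewrite (_ : (fun _ _ => _) = fun v t => y i 0 + t * (J *m v) i 0).
  apply: poly_familyD; first exact/poly_family_cst/polyfun_cst.
  apply: poly_familyM; first exact: poly_family_var.
  exact/poly_family_cst/polyfun_mulmx.
by apply/funext => v; apply/funext => t; rewrite !mxE.
Qed.

(** The generic situation at v.  It is a condition on every z, not just on the
branch followed along u: the conditions on single signs hold almost everywhere,
and which branch is followed is a consequence of them. *)
Definition settled (R : realType) (d n T : nat) (P : program R T)
    (u : 'cV[R]_d -> R -> 'cV[R]_n) (v : 'cV[R]_d) : Prop :=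
  forall (z : signs T) (k : 'I_T), exists b : bool,
    \forall w \near cone v, (0 <= branch_constraint P z k (u w.1 w.2)) = b.

Lemma settled_null (R : realType) (d n T : nat) (P : program R T)
    (u : 'cV[R]_d -> R -> 'cV[R]_n) :
  poly_path u -> lebesgue_null [set v | ~ settled P u v].
Proof.
move=> pu; apply: lebesgue_null_forall => z; apply: lebesgue_null_forall => k.
have := poly_family_sign_near
  (poly_path_comp (@polyfun_branch_constraint R n T P z k) pu).
apply: lebesgue_null_sub => v /=; apply: contra_not => -[b signb]; exists b.
exact: (cone_near (Q := fun v t => (0 <= branch_constraint P z k (u v t)) = b)).
Qed.

Lemma settled_branch_set (R : realType) (d n T : nat) (P : program R T)
    (u : 'cV[R]_d -> R -> 'cV[R]_n) (v : 'cV[R]_d) (z : signs T) :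
  settled P u v ->
  (\forall w \near cone v, branch_set P z (u w.1 w.2)) \/
  (\forall w \near cone v, ~ branch_set P z (u w.1 w.2)).
Proof.
move=> /(_ z)/choice[b signb].
have nearb : \forall w \near cone v,
    forall k, (0 <= branch_constraint P z k (u w.1 w.2)) = b k.
  exact: filter_forall.
have [bz|/existsNP[k bz]] := pselect (forall k, b k = z k).
  by left; apply: filterS nearb => w wb k; rewrite wb bz.
by right; apply: filterS nearb => w wb /(_ k); rewrite wb.
Qed.

(** The finitely many branch sets cover the whole space, so a thin cone cannot
avoid them all. *)
Lemma settled_branch (R : realType) (d n T : nat) (P : program R T)
    (u : 'cV[R]_d -> R -> 'cV[R]_n) (v : 'cV[R]_d) :
  settled P u v ->
  exists z, \forall w \near cone v, branch_set P z (u w.1 w.2).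
Proof.
move=> uv; apply: contrapT => /forallNP none.
have nearN : \forall w \near cone v, forall z, ~ branch_set P z (u w.1 w.2).
  by apply: filter_forall => z; have [/none|] := settled_branch_set z uv.
have [w wN] := filter_ex nearN.
by have [z /wN] := branch_set_cover P (u w.1 w.2).
Qed.

Lemma near_linear_eq0 (R : realType) (n : nat) (a v : 'cV[R]_n) :
  (\forall v' \near v, \sum_i (v' : 'cV[R]_n) i 0 * a i 0 = 0) -> a = 0.
Proof.
move=> near0; apply/colP => i; rewrite mxE.
have /filter_ex[t [t0]] : \forall t \near (0 : R)^'+, 0 < t /\
    \sum_j (v + t *: delta_mx i 0) j 0 * a j 0 = 0.
  near=> t; split; first by near: t; exact: nbhs_right_gt.
  by near: t; exact: (@cvg_ray _ _ v (delta_mx i 0) _ near0).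
under eq_bigr do rewrite mxE mulrDl.
rewrite big_split/= (nbhs_singleton near0) add0r (bigD1 i)//= big1; last first.
  by move=> j ji; rewrite !mxE (negPf ji) mulr0 mul0r.
rewrite !mxE !eqxx mulr1 addr0 => /eqP; rewrite mulf_eq0 gt_eqF//= => /eqP.
by [].
Unshelve. all: by end_near. Qed.

(** * The chain rule *)

(** The limiting Jacobian of g, when each g_i follows its branch z i. *)
Definition branch_jacobian (R : realType) (d m : nat) (T : 'I_m -> nat)
    (P : forall i, program R (T i)) (z : {dffun forall i, signs (T i)})
    (x : 'cV[R]_d) : 'M[R]_(m, d) :=
  \matrix_(i, j) grad (branch_output (P i) (z i)) x j 0.

Lemma branch_jacobianE (R : realType) (d m : nat) (T : 'I_m -> nat)
    (P : forall i, program R (T i)) (z : {dffun forall i, signs (T i)})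
    (x v : 'cV[R]_d) (i : 'I_m) :
  (branch_jacobian P z x *m v) i 0 =
  \sum_j v j 0 * grad (branch_output (P i) (z i)) x j 0.
Proof. by rewrite mxE; apply: eq_bigr => j _; rewrite mxE mulrC. Qed.

(** The generic case.  The three settling hypotheses concern the rays from x for
the programs of the g_i, and, for the program of h, the tangent rays from g(x) and
the image curves of the rays from x.  They are required for every choice z of
branches of the g_i, since the branches followed depend on v.  Along the tangent
rays, the branch zh selected by the subroutine gives the directional derivative
of h in all directions J v' with v' near v; along the image curves, the branch zf
makes f polynomial.  The two branches need not coincide, and are only compared
through directional derivatives. *)
Lemma chain_rule_settled (R : realType) (d m : nat)
    (h : 'cV[R]_m -> R) (g : 'I_m -> 'cV[R]_d -> R)
    (Th : nat) (Ph : program R Th)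
    (T : 'I_m -> nat) (P : forall i, program R (T i))
    (asd : 'cV[R]_m -> 'cV[R]_m -> R * R * 'cV[R]_m) (x v : 'cV[R]_d) :
  computes Ph h -> locally_lipschitz h ->
  (forall i, computes (P i) (g i)) -> (forall i, locally_lipschitz (g i)) ->
  is_ASD Ph h asd ->
  let y := \col_i g i x in
  (forall i, settled (P i) (fun v t => x + t *: v) v) ->
  (forall z : {dffun forall i, signs (T i)},
    settled Ph (fun v t => y + t *: (branch_jacobian P z x *m v)) v) ->
  (forall z : {dffun forall i, signs (T i)},
    settled Ph (fun v t => \col_i branch_output (P i) (z i) (x + t *: v)) v) ->
  let: (a, c, u) := asd y (\col_i dirder (g i) v x) in
  exists (df : 'cV[R]_d) (Jg : 'M[R]_(m, d)),
    [/\ is_limder (fun y => h (\col_i g i y)) v x df, is_limjac g v x Jg &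
        df = Jg^T *m u].
Proof.
move=> hP lh gP lg asdP y settled_g settled_tangent settled_f.
pose z0 i := cid (settled_branch (settled_g i)).
pose z : {dffun forall i, signs (T i)} := [ffun i => projT1 (z0 i)].
pose p i := @branch_output R d (T i) (P i) (z i).
have pp i : polyfun (p i) by exact: polyfun_branch_output.
have gp i : \forall w \near cone v, g i (x + w.2 *: w.1) = p i (x + w.2 *: w.1).
  apply: filterS (projT2 (z0 i)) => w zw; rewrite /p ffunE.
  exact: branch_set_output.
pose J := branch_jacobian P z x.
pose g_diff i (v' : 'cV[R]_d) :=
  (g i (x + t *: v') - g i x) / t @[t --> 0^'+] --> (J *m v') i 0.
have g_quot : \forall v' \near v, forall i, g_diff i v'.
  apply: (@filter_forall _ _ g_diff (nbhs v) (nbhs_filter v)) => i.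
  have := cone_near_rays (Q := fun v' t => g i (x + t *: v') = p i (x + t *: v')) (gp i).
  apply: filterS => v' gpv'.
  rewrite /g_diff branch_jacobianE.
  apply: (near_ray_quotient (phi := g i) _ (pp i) gpv').
  exact: locally_lipschitz_continuous.
have dirderE : \col_i dirder (g i) v x = J *m v.
  apply/colP => i; rewrite mxE /dirder; apply: cvg_lim => //.
  exact: (nbhs_singleton g_quot i).
rewrite dirderE; have := asdP y (J *m v).
case: (asd y (J *m v)) => [[a c] u] [_ _ [zh zhv uE]].
(* The subroutine only tells that the ray of v itself enters the branch zh; the
   sign conditions being settled, so do the rays of all v' near v. *)
have zh_tangent : \forall w \near cone v, branch_set Ph zh (y + w.2 *: (J *m w.1)).
  have [//|out] := settled_branch_set zh (settled_tangent z).
  have out_v := cone_near_ray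
    (Q := fun v t => ~ branch_set Ph zh (y + t *: (J *m v))) out.
  have : (\1_(branch_set Ph zh) (y + delta *: (J *m v)) : R)
      @[delta --> 0^'+] --> (0 : R).
    apply: cvg_near_cst; apply: filterS out_v => t tN.
    by rewrite indicE memNset.
  move=> zh0; have one0 : (1 : R) = 0 by exact: (cvg_unique _ zhv zh0).
  by move/eqP: one0; rewrite oner_eq0.
have h_quot : \forall v' \near v,
    (h (y + t *: (J *m v')) - h y) / t @[t --> 0^'+] --> \sum_k (J *m v') k 0 * u k 0.
  apply: filterS (cone_near_rays
    (Q := fun v t => branch_set Ph zh (y + t *: (J *m v))) zh_tangent) => v' zv'.
  rewrite uE; apply: (near_ray_quotient (phi := h)).
  - exact: locally_lipschitz_continuous.
  - exact: polyfun_branch_output.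
  - by apply: filterS zv' => t; exact: branch_set_output.
have [zf zfP] := settled_branch (settled_f z).
pose q x' := branch_output Ph zf (\col_i p i x').
have pq : polyfun q by apply: polyfun_comp => //; exact: polyfun_branch_output.
have fq : \forall w \near cone v,
    h (\col_i g i (x + w.2 *: w.1)) = q (x + w.2 *: w.1).
  have allgp : \forall w \near cone v,
    forall i, g i (x + w.2 *: w.1) = p i (x + w.2 *: w.1) by exact: filter_forall.
  apply: filterS2 allgp zfP => w gpw zfw.
  rewrite (_ : \col_i g i (x + w.2 *: w.1) = \col_i p i (x + w.2 *: w.1)).
    exact: branch_set_output.
  by apply/colP => i; rewrite !mxE gpw.
exists (grad q x), J; split.
- exact: cone_limder.
- move=> i; rewrite (_ : (row i J)^T = grad (p i) x); first exact: cone_limder.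
  by apply/colP => j; rewrite !mxE.
(* Both sides are linear forms; they agree at all v' near v, where both compute
   the directional derivative of f. *)
apply/eqP; rewrite -subr_eq0; apply/eqP; apply: (@near_linear_eq0 _ _ _ v).
have f_ray := cone_near_rays (Q := fun v' t =>
  h (\col_i g i (x + t *: v')) = q (x + t *: v')) fq.
near=> v'.
have gv' : forall i, g_diff i v'.
  by near: v'; exact: g_quot.
have hv' : (h (y + t *: (J *m v')) - h y) / t @[t --> 0^'+]
    --> \sum_k (J *m v') k 0 * u k 0 by near: v'; exact: h_quot.
have fv' : \forall t \near 0^'+, h (\col_i g i (x + t *: v')) = q (x + t *: v').
  by near: v'; exact: f_ray.
have f_quot : (h (\col_i g i (x + t *: v')) - h y) / t @[t --> 0^'+]
    --> \sum_k (J *m v') k 0 * u k 0.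
  apply: (lipschitz_chain_quotient lh _ hv'); apply: cvg_cV => i.
  apply: cvg_trans (gv' i); apply: near_eq_cvg.
  by near=> t; rewrite !mxE mulrC.
have cf : {for x, continuous (fun x' => h (\col_i g i x'))}.
  apply: (@continuous_comp _ _ _ (fun x' => \col_i g i x') h); last first.
    exact: locally_lipschitz_continuous.
  apply: (@cvg_cV _ _ _ (nbhs x) _ _ (nbhs_filter x)) => i; rewrite mxE.
  under eq_cvg do rewrite mxE.
  exact: locally_lipschitz_continuous.
have q_quot := near_ray_quotient cf pq fv'.
have dqE := cvg_unique (@Rhausdorff R) q_quot f_quot.
have subE i : (grad q x - J^T *m u) i 0 = grad q x i 0 - (J^T *m u) i 0.
  by rewrite !mxE.
under eq_bigr do rewrite subE mulrBr.
rewrite sumrB dqE; apply/eqP; rewrite subr_eq0; apply/eqP.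
under eq_bigr do rewrite mxE big_distrl/=.
rewrite exchange_big/=; apply: eq_bigr => j _.
rewrite [in RHS]mxE big_distrr/=; apply: eq_bigr => k _.
by rewrite [J^T _ _]mxE mulrCA mulrA.
Unshelve. all: by end_near. Qed.

Theorem theorem3p2 (R : realType) (d m : nat)
    (h : 'cV[R]_m -> R) (g : 'I_m -> 'cV[R]_d -> R)
    (Th : nat) (Ph : program R Th)
    (asd : 'cV[R]_m -> 'cV[R]_m -> R * R * 'cV[R]_m) (x : 'cV[R]_d) :
  computes Ph h -> locally_lipschitz h ->
  (forall i, computable (g i)) -> (forall i, locally_lipschitz (g i)) ->
  is_ASD Ph h asd ->
  let f : 'cV[R]_d -> R := fun y => h (\col_i g i y) in
  lebesgue_null [set v : 'cV[R]_d |
    ~ (let: (a, c, u) := asd (\col_i g i x) (\col_i dirder (g i) v x) in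
       exists (df : 'cV[R]_d) (Jg : 'M[R]_(m, d)),
         [/\ is_limder f v x df, is_limjac g v x Jg & df = Jg^T *m u])].
Proof.
move=> hP lh gcomp lg asdP f.
have gcomp' i : exists TP : {T : nat & program R T}, computes (projT2 TP) (g i).
  by have [T [P gP]] := gcomp i; exists (existT _ T P).
have [TP gP] := choice gcomp'.
pose T i := projT1 (TP i).
pose P i : program R (T i) := projT2 (TP i).
have line : poly_path (fun v t => x + t *: v).
  have := poly_path_ray x 1%:M; congr poly_path.
  by apply/funext => v; apply/funext => t; rewrite mul1mx.
have null_g : lebesgue_null [set v |
    ~ forall i, settled (P i) (fun v t => x + t *: v) v].
  by apply: lebesgue_null_forall => i; exact: settled_null.
have null_tangent : lebesgue_null [set v |
    ~ forall z : {dffun forall i, signs (T i)}, settled Ph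
        (fun v t => \col_i g i x + t *: (branch_jacobian P z x *m v)) v].
  apply: lebesgue_null_forall => z; apply: settled_null.
  exact: poly_path_ray.
have null_f : lebesgue_null [set v |
    ~ forall z : {dffun forall i, signs (T i)}, settled Ph
        (fun v t => \col_i branch_output (P i) (z i) (x + t *: v)) v].
  apply: lebesgue_null_forall => z; apply: settled_null => i.
  have := poly_path_comp (@polyfun_branch_output R d _ (P i) (z i)) line.
  by congr poly_family; apply/funext => v; apply/funext => t; rewrite mxE.
apply: lebesgue_null_sub (lebesgue_null_and null_g
  (lebesgue_null_and null_tangent null_f)) => v.
apply: contra_not => -[settled_g [settled_tangent settled_f]].
exact: chain_rule_settled settled_g settled_tangent settled_f.
Qed.
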